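(* (Maximal moment inequality) Let $Z_1,\dots,Z_n$ be independent random vectors in $\mathbb{R}^M$, and let $Z_{i,j}$ denote the $j$-th component of $Z_i$ (assumed integrable). Then for any $m\ge1$ and $M\ge1$ we have $$\mathbb{E}\Bigl(\max_{1\le j\le M}\Bigl|\sum_{i=1}^n\bigl(Z_{i,j}-\mathbb{E}Z_{i,j}\bigr)\Bigr|^m\Bigr)\le\bigl[8\log(c(m)M)\bigr]^{m/2}\,\mathbb{E}\Bigl(\Bigl[\max_{1\le j\le M}\sum_{i=1}^nZ_{i,j}^2\Bigr]^{m/2}\Bigr),$$ where $c(m)=\min\{c>0:\ e^{m-1}-1\le(c-2)M\}$. In particular, $2\le c(m)\le e^{m-1}+1$.
   Context: Here $m$ is a real number; the right-hand side may be $+\infty$. *)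

(* Defs.v *)
From mathcomp Require Import all_boot all_order all_algebra.
From mathcomp Require Import all_classical all_reals all_analysis.

Set Implicit Arguments.
Unset Strict Implicit.
Unset Printing Implicit Defensive.

Import Order.TTheory GRing.Theory Num.Theory.

Local Open Scope classical_set_scope.
Local Open Scope ring_scope.

(* For random vectors, T' is M.-tuple R with the library's product
   sigma-algebra, that is, the Borel sigma-algebra of R^M. *)
Definition mutually_independent (R : realType) (d d' : measure_display)
    (T : measurableType d) (T' : measurableType d') (P : probability T R)
    (I : finType) (X : I -> {RV P >-> T'}) : Prop :=
  forall (J : {set I}) (B : I -> set T'),
    (forall i, i \in J -> measurable (B i)) ->
    P (\bigcap_(i in [set` J]) (X i @^-1` B i)) =
    (\prod_(i in J) P (X i @^-1` B i))%E.

(* The family of real random variables w |-> (Z w)_j. *)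
Definition component (R : realType) (d : measure_display)
    (T : measurableType d) (P : probability T R) (M : nat)
    (Z : {RV P >-> (M.-tuple R)%type}) (j : 'I_M) : T -> R :=
  fun w => tnth (Z w) j.

Definition c_admissible (R : realType) (M : nat) (m : R) : set R :=
  [set c | 0 < c /\ expR (m - 1) - 1 <= (c - 2) * M%:R].

(* Meant as a minimum; [inf] makes it a total function, so whether it is
   attained has to be stated separately. *)
Definition c_min (R : realType) (M : nat) (m : R) : R := inf (c_admissible M m).

(* Main.v *)
Require Import Defs.
From HB Require Import structures.
From mathcomp Require Import all_boot all_order all_algebra ring lra.
From mathcomp Require Import all_classical all_reals all_analysis.
From mathcomp Require Import measurable_realfun.

(* Symmetrization: with an independent copy Z' of Z, Jensen's inequality
   replaces E Z by Z', and the law of Z - Z' is not changed by flipping the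
   signs of any set of indices; splitting the difference by convexity of the
   m-th power costs 2^m and leaves sum_i e_i Z_i for an arbitrary sign vector e.
   Averaging over e, it remains to bound, for fixed vectors z_i, the mean over e
   of X^m with X = max_j |sum_i e_i z_ij|. Hoeffding's bound gives
   E exp (l X) <= 2 M exp (l^2 v / 2) with v = max_j sum_i z_ij^2, and
   u |-> (ln u)^m is concave for u >= exp (m - 1), so that the tangent inequality
   at u = exp (2 ln (c M)) turns this into a bound on E X^m; the shift by
   exp (m - 1) - 1 that moves exp (l X) into the domain of concavity is what the
   constant c(m) absorbs. *)

Import Order.TTheory GRing.Theory Num.Theory.
Import numFieldNormedType.Exports.

Local Open Scope classical_set_scope.
Local Open Scope ring_scope.

Set Implicit Arguments.
Unset Strict Implicit.

(** * One-variable inequalities for [expR] and [powR] *)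

Lemma MVT_derivable (R : realType) (f df : R -> R) (a b : R) : a < b ->
  (forall x, a <= x <= b -> is_derive x 1 f (df x)) ->
  exists2 c, a < c < b & f b - f a = df c * (b - a).
Proof.
move=> ab fdf; have [||c cab ->] := @MVT _ f df _ _ ab.
- by move=> x; rewrite in_itv/= => /andP[/ltW ax /ltW xb]; apply: fdf; rewrite ax.
- apply: derivable_within_continuous => x; rewrite in_itv/= => xab.
  by have [] := fdf _ xab.
- by exists c => //; move: cab; rewrite in_itv.
Qed.

(** Right side minus left side vanishes at [0] and has derivative [x * (expR x - expR (- x))],
    nonnegative for [x >= 0]. *)
Lemma mulr_coshR_ge_sinhR (R : realType) (x : R) : 0 <= x ->
  expR x - expR (- x) <= x * (expR x + expR (- x)).
Proof.
rewrite le_eqVlt => /predU1P[<-|x0]; first by rewrite mul0r oppr0 subrr.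
have dF (y : R) : is_derive y 1
    (fun y : R => y * (expR y + expR (- y)) - (expR y - expR (- y)))
    (y * (expR y - expR (- y))).
  by apply: is_derive_eq; rewrite /GRing.scale/=; ring.
have [c /andP[c0 _]] := MVT_derivable x0 (fun y _ => dF y).
rewrite mul0r oppr0 !subrr subr0 addr0 -subr_ge0 => ->.
apply: mulr_ge0; last exact: ltW.
by apply: mulr_ge0; [exact: ltW|rewrite subr_ge0 ler_expR; lra].
Qed.

(** By evenness take [x >= 0]. The quotient of the left side by [expR (x ^+ 2 / 2)] equals [2] at
    [0], and its derivative is nonpositive by the previous inequality. *)
Lemma coshR_le_expR_sqr (R : realType) (x : R) :
  expR x + expR (- x) <= 2 * expR (x ^+ 2 / 2).
Proof.
wlog x0 : x / 0 <= x => [hx|].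
  have [/hx//|/ltW x0] := leP 0 x.
  by have := hx (- x); rewrite opprK sqrrN addrC; apply; lra.
rewrite -ler_pdivrMr ?expR_gt0// -expRN.
move: x0; rewrite le_eqVlt => /predU1P[<-|x0].
  by rewrite expr0n/= mul0r oppr0 expR0 mulr1.
have dF (y : R) : is_derive y 1
    (fun y : R => (expR y + expR (- y)) * expR (- (y ^+ 2 / 2)))
    (expR (- (y ^+ 2 / 2)) *
      ((expR y - expR (- y)) - y * (expR y + expR (- y)))).
  by apply: is_derive_eq; rewrite /GRing.scale/=; field.
have [c /andP[c0 _]] := MVT_derivable x0 (fun y _ => dF y).
rewrite !expr0n/= !mul0r !oppr0 !expR0 mulr1 addr0 => h.
rewrite -subr_le0 -[X in _ - X]/(1 + 1) h.
rewrite pmulr_lle0// pmulr_rle0 ?expR_gt0// subr_le0.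
by rewrite mulr_coshR_ge_sinhR// ltW.
Qed.

(** In logarithms the claim reads [p * (ln b - ln a) <= b - a]; it follows from
    [ln (b / a) <= b / a - 1] and [p <= a]. *)
Lemma powR_mul_expRN_le (R : realType) (p a b : R) : 0 <= p -> p <= a -> 0 < a ->
  a <= b -> b `^ p * expR (- b) <= a `^ p * expR (- a).
Proof.
move=> p0 pa a0 ab; have b0 : 0 < b by exact: lt_le_trans ab.
rewrite /powR !gt_eqF// -!expRD ler_expR.
have /ler_wpM2l-/(_ _ p0) : ln b - ln a <= b / a - 1.
  rewrite -ln_div ?posrE//; have := expR_ge1Dx (ln (b / a)).
  by rewrite lnK ?posrE ?divr_gt0//; lra.
have : p * (b / a - 1) <= b - a.
  have -> : b - a = a * (b / a - 1) by field; rewrite gt_eqF.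
  by rewrite ler_wpM2r// subr_ge0 ler_pdivlMr// mul1r.
lra.
Qed.

(* Since [x `^ (m - 1) * expR (- x)] decreases on [m - 1, +oo), the map
   [u |-> ln u `^ m] is concave for [u >= expR (m - 1)]: this is its tangent
   inequality at [expR a], read in the variable [b = ln u]. *)
Lemma powR_le_expR_tangent (R : realType) (m a b : R) : 1 <= m ->
  m - 1 <= a -> 0 < a -> m - 1 <= b ->
  b `^ m <= a `^ m + m * a `^ (m - 1) * (expR (b - a) - 1).
Proof.
move=> m1 ma a0 mb; have m0 : 0 < m by lra.
have b0 : 0 <= b by lra.
(* The value [b = 0] forces [m = 1], and the claim becomes [1 - a <= expR (- a)]. *)
move: b0; rewrite le_eqVlt => /predU1P[b0|b0].
  have -> : m = 1 by lra.
  rewrite -b0 subrr !powRr1 ?lexx ?(ltW a0)// powRr0 sub0r.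
  by have := expR_ge1Dx (- a); lra.
(* The factor [k] makes the derivative of [h] vanish at [a]. The claim is that [h] is largest at
   [a]: between [a] and [b] all points are at least [m - 1], where the monotonicity above fixes the
   sign of the derivative. *)
pose k := m * a `^ (m - 1) * expR (- a).
pose h (x : R) := x `^ m - k * expR x.
suff : h b <= h a.
  rewrite /h /k -!mulrA -!expRD addNr expR0 mulr1 [- a + b]addrC; lra.
have dh (x : R) : 0 < x -> is_derive x 1 h (m * expR x *
    (x `^ (m - 1) * expR (- x) - a `^ (m - 1) * expR (- a))).
  move=> x0; have dp := is_derive1_powR m x0; apply: is_derive_eq.
rewrite /GRing.scale/= /k mulrBr.
  rewrite [x `^ _ * _]mulrC !mulrA -[_ * expR x * expR (- x)]mulrA -expRD subrr expR0.
  ring.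
have [ab|ba|->//] := ltgtP a b.
- have [|c /andP[ac cb] hE] := MVT_derivable (f := h) ab (df :=
    fun x => m * expR x * (x `^ (m - 1) * expR (- x) - a `^ (m - 1) * expR (- a))).
    by move=> x /andP[ax _]; apply: dh; lra.
  rewrite -subr_le0 hE pmulr_lle0 ?subr_gt0// pmulr_rle0 ?mulr_gt0 ?expR_gt0//.
  by rewrite subr_le0 powR_mul_expRN_le//; lra.
- have [|c /andP[bc ca] hE] := MVT_derivable (f := h) ba (df :=
    fun x => m * expR x * (x `^ (m - 1) * expR (- x) - a `^ (m - 1) * expR (- a))).
    by move=> x /andP[ax _]; apply: dh; lra.
  rewrite -subr_ge0 hE pmulr_lge0 ?subr_gt0// pmulr_rge0 ?mulr_gt0 ?expR_gt0//.
  by rewrite subr_ge0 powR_mul_expRN_le//; lra.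
Qed.

(** * Moments of sums with random signs *)

(** Hoeffding's bound, with a sum over sign vectors in place of a mean: the sum of products factors
    over the indices, and each factor is a two-term sum bounded by [coshR_le_expR_sqr]. *)
Lemma sum_sign_expR_le (R : realType) (n : nat) (a : 'I_n -> R) :
  \sum_(e : {ffun 'I_n -> bool}) expR (\sum_i (-1) ^+ e i * a i)
    <= 2 ^+ n * expR ((\sum_i a i ^+ 2) / 2).
Proof.
under eq_bigr do rewrite expR_sum.
rewrite -(bigA_distr_bigA (fun i (b : bool) => expR ((-1) ^+ b * a i)))/=.
have -> : 2 ^+ n = \prod_(i < n) 2 :> R by rewrite prodr_const card_ord.
rewrite mulr_suml expR_sum -big_split/=.
apply: ler_prod => i _; rewrite big_bool/= expr1 expr0 mul1r mulN1r addrC.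
by rewrite addr_ge0 ?expR_ge0//= coshR_le_expR_sqr.
Qed.

Lemma powR_half (R : realType) (x m : R) : 0 <= x -> x `^ (m / 2) = Num.sqrt x `^ m.
Proof. by move=> x0; rewrite mulrC powRrM powR12_sqrt. Qed.

(** The quantity [expR x - 1 + expR (m - 1)] dominates both [expR x] and [expR (m - 1)]. Its
    logarithm therefore lies in the domain of the tangent inequality and is at least [x]. *)
Lemma powR_le_expR_tangent_shift (R : realType) (m a x : R) :
  1 <= m -> m - 1 <= a -> 0 < a -> 0 <= x ->
  x `^ m <= a `^ m +
    m * a `^ (m - 1) * ((expR x - 1 + expR (m - 1)) * expR (- a) - 1).
Proof.
move=> m1 ma a0 x0.
have em : 1 <= expR (m - 1) by have := expR_ge1Dx (m - 1); lra.
have ex : 1 <= expR x by have := expR_ge1Dx x; lra.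
have u0 : 0 < expR x - 1 + expR (m - 1) by lra.
pose b := ln (expR x - 1 + expR (m - 1)).
have eb : expR b = expR x - 1 + expR (m - 1) by rewrite /b lnK// posrE.
have xb : x <= b by rewrite -ler_expR eb; lra.
have mb : m - 1 <= b by rewrite -ler_expR eb; lra.
apply: (@le_trans _ _ (b `^ m)).
  by apply: ge0_ler_powR => //; rewrite ?nnegrE; lra.
by rewrite -eb -expRD; exact: powR_le_expR_tangent.
Qed.

Lemma sum_sign_bigmax_powR_le (R : realType) (n M : nat) (m c : R)
    (z : 'I_n -> 'I_M -> R) : (1 <= M)%N -> 1 <= m ->
  expR (m - 1) - 1 <= (c - 2) * M%:R ->
  \sum_(e : {ffun 'I_n -> bool})
     \big[Num.max/0]_(j < M) (`|\sum_i (-1) ^+ e i * z i j| `^ m)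
  <= 2 ^+ n * ((2 * ln (c * M%:R)) `^ (m / 2) *
       (\big[Num.max/0]_(j < M) \sum_i z i j ^+ 2) `^ (m / 2)).
Proof.
move=> M1 m1 hc.
have M1R : 1 <= M%:R :> R by rewrite ler1n.
have em : 1 <= expR (m - 1) by have := expR_ge1Dx (m - 1); lra.
have cM2 : 2 <= c * M%:R by lra.
set v := \big[Num.max/0]_(j < M) \sum_i z i j ^+ 2.
(* The tangent will be taken at [2 * L]; admissibility of [c] gives [m - 1 <= L], hence
   [m - 1 <= 2 * L]. *)
pose L : R := ln (c * M%:R).
have eL : expR L = c * M%:R by rewrite lnK// posrE; lra.
have L0 : 0 < L by rewrite ln_gt0//; lra.
have Lm : m - 1 <= L by rewrite -ler_expR eL; lra.
have v0 : 0 <= v by exact: bigmax_ge_id.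
have zv j : \sum_i z i j ^+ 2 <= v by exact: le_bigmax.
(* If [v] vanishes, so do all [z i j] and the left side; otherwise [lam] below is well defined. *)
have [v_gt0|v_le0] := ltP 0 v; last first.
  have z0 i j : z i j = 0.
    apply/eqP; rewrite -sqrf_eq0 eq_le sqr_ge0 andbT.
    apply: le_trans v_le0; apply: le_trans (zv j).
    by rewrite (bigD1 i)//= lerDl sumr_ge0// => *; rewrite sqr_ge0.
  rewrite big1 ?mulr_ge0 ?powR_ge0 ?exprn_ge0// => e _.
  apply: big1_idem => [|j _]; first exact: maxxx.
  by rewrite big1 => [|i _]; rewrite ?z0 ?mulr0// normr0 powR0//; lra.
pose r := Num.sqrt (2 * L * v).
have r0 : 0 < r by rewrite sqrtr_gt0 !mulr_gt0.
pose lam := (2 * L) / r.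
have lam0 : 0 < lam by rewrite divr_gt0 ?mulr_gt0.
have lamv : lam ^+ 2 * v / 2 = L.
  rewrite /lam exprMn exprVn sqr_sqrtr ?mulr_ge0 ?ltW//.
  by field; rewrite !gt_eqF.
rewrite powR_half ?mulr_ge0 ?(ltW L0)// powR_half// -powRM ?sqrtr_ge0//.
rewrite -sqrtrM ?mulr_ge0 ?(ltW L0)// -/r.
have -> : r = 2 * L / lam by rewrite /lam; field; rewrite !gt_eqF.
pose S (e : {ffun 'I_n -> bool}) j := \sum_i (-1) ^+ e i * z i j.
pose D := m * (2 * L) `^ (m - 1).
have L20 : 0 < 2 * L by rewrite mulr_gt0.
have D0 : 0 <= D by rewrite mulr_ge0 ?powR_ge0//; lra.
pose psi e := \sum_j (expR (lam * S e j) + expR (- (lam * S e j))) - 1 + expR (m - 1).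
have maxN e : lam `^ m * \big[Num.max/0]_(j < M) (`|S e j| `^ m) <=
    (2 * L) `^ m + D * (psi e * expR (- (2 * L)) - 1).
  have bnd j : (lam * `|S e j|) `^ m <=
      (2 * L) `^ m + D * (psi e * expR (- (2 * L)) - 1).
    have x0 : 0 <= lam * `|S e j| by rewrite mulr_ge0// ltW.
    apply: le_trans (powR_le_expR_tangent_shift m1 _ L20 x0) _; first lra.
    rewrite lerD2l ler_wpM2l// lerD2r ler_wpM2r ?expR_ge0// !lerD2r.
    rewrite (bigD1 j)//= -[leLHS]addr0 lerD//; last first.
      by apply: sumr_ge0 => *; rewrite addr_ge0 ?expR_ge0.
    have [_|_] := ger0P (S e j); first by rewrite lerDl expR_ge0.
    by rewrite mulrN lerDr expR_ge0.
  rewrite -ler_pdivlMl ?powR_gt0//; apply: bigmax_le => [|j _].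
    (* The starting value [0] of the maximum must be bounded too; an index exists since [M >= 1],
       and [bnd] there shows the right side nonnegative. *)
    rewrite ler_pdivlMl ?powR_gt0// mulr0.
    exact: le_trans (powR_ge0 _ _) (bnd (Ordinal M1)).
  by rewrite ler_pdivlMl ?powR_gt0// -powRM ?bnd// ltW.
(* Here the constant is used: since [expR L >= 1], the shift [expR (m - 1) - 1 <= (c - 2) * M] is at
   most [(c - 2) * M * expR L]. Added to [2 * M * expR L], this gives
   [c * M * expR L = expR (2 * L)]. *)
have sumpsi : \sum_e psi e <= 2 ^+ n * expR (2 * L).
  rewrite /psi 2!big_split/= !sumr_const card_ffun card_bool card_ord exchange_big/=.
  have expS j (s : R) : s ^+ 2 = lam ^+ 2 ->
      \sum_e expR (s * S e j) <= 2 ^+ n * expR L.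
    move=> slam; under eq_bigr do rewrite mulr_sumr.
    under eq_bigr do under eq_bigr do rewrite mulrCA.
    apply: le_trans (sum_sign_expR_le _) _.
    rewrite ler_pM2l ?exprn_gt0// ler_expR -lamv ler_wpM2r//.
    under eq_bigr do rewrite exprMn slam.
    by rewrite -mulr_sumr ler_wpM2l// sqr_ge0.
  apply: (@le_trans _ _ (\sum_(j < M) (2 ^+ n * expR L *+ 2) +
      2 ^+ n * (expR (m - 1) - 1))).
    rewrite -addrA; apply: lerD; last by rewrite mulrBr mulr1 -(mulr_natl (- 1)) -(mulr_natl (expR _)) natrX; lra.
    apply: ler_sum => j _; rewrite big_split/= mulr2n lerD ?expS//.
    by under eq_bigr do rewrite -mulNr; rewrite expS// sqrrN.
  have -> : expR (2 * L) = expR L * (c * M%:R).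
    by rewrite -eL -expRD; congr expR; ring.
  rewrite sumr_const card_ord.
  rewrite [leLHS](_ : _ = 2 ^+ n * (2 * M%:R * expR L + (expR (m - 1) - 1))); last first.
    by rewrite -(mulr_natr _ M); ring.
  rewrite ler_pM2l ?exprn_gt0//.
  have eL1 : 1 <= expR L by lra.
  have : (c - 2) * M%:R <= (c - 2) * M%:R * expR L.
    by rewrite ler_peMr//; lra.
  lra.
rewrite -(ler_pM2l (powR_gt0 m lam0)) mulrCA -powRM ?(ltW lam0)//; last first.
  by apply/ltW/divr_gt0.
have -> : lam * (2 * L / lam) = 2 * L by field; rewrite gt_eqF.
rewrite mulr_sumr.
apply: le_trans (ler_sum _ (fun e _ => maxN e)) _.
(* By [sumpsi] the linear terms of the tangent bound sum to something nonpositive, leaving [2 ^+ n]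
   copies of the constant term. *)
rewrite big_split/= -mulr_sumr big_split/= -mulr_suml !sumr_const.
rewrite card_ffun card_bool card_ord -(mulr_natl (_ `^ _)) -(mulr_natl (- 1)) natrX gerDl.
rewrite mulr_ge0_le0// mulrN1 subr_le0 -ler_pdivlMr ?expR_gt0//.
by rewrite -expRN opprK.
Qed.

(** * Laws of tuples and exchange of independent copies *)

(** Unlike cylinders over a single coordinate, these sets are stable under intersection, as
    uniqueness of measures requires of a generating class. *)
Definition tuple_rectangles (d : measure_display) (T : measurableType d)
    (n : nat) : set (set (n.-tuple T)) :=
  [set A | exists2 B : 'I_n -> set T, (forall i, measurable (B i)) &
    A = \bigcap_(i in [set: 'I_n]) [set t | B i (tnth t i)]].

Lemma measurable_tuple_rectangles (d : measure_display) (T : measurableType d)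
    (n : nat) : @measurable _ (n.-tuple T) = <<s @tuple_rectangles _ T n >>.
Proof.
have rect_meas : @tuple_rectangles _ T n `<=` @measurable _ (n.-tuple T).
  move=> _ [B mB ->]; apply: fin_bigcap_measurable => // i _.
  have := @measurable_tnth _ T n i measurableT _ (mB i).
  by rewrite setTI.
apply/seteqP; split; last first.
  exact: (smallest_sub (@sigma_algebra_measurable _ _)).
apply: smallest_sub; first exact: smallest_sigma_algebra.
rewrite big_tnth => A; elim/big_ind: _ => //.
  by move=> U V hU hV [/hU|/hV].
move=> i _ [B mB <-]; apply: sub_sigma_algebra.
set k := tnth _ i.
exists (fun j => if j == k then B else setT) => [j|]; first by case: ifP.
apply/seteqP; split => [t [_ Bt] j _ /=|t /(_ k I)/=].
  by case: eqP => [->|].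
by rewrite eqxx.
Qed.

(** Both integrals are integrals of [f] against the law of a tuple; two probability laws that agree
    on rectangles are equal. *)
Lemma eq_integral_tuple_law (R : realType) (d d' : measure_display)
    (T : measurableType d) (T' : measurableType d') (P : probability T R)
    (n : nat) (X Y : 'I_n -> T -> T') (f : n.-tuple T' -> R) :
  (forall i, measurable_fun setT (X i)) ->
  (forall i, measurable_fun setT (Y i)) ->
  (forall B : 'I_n -> set T', (forall i, measurable (B i)) ->
    P (\bigcap_(i in [set: 'I_n]) (X i @^-1` B i)) =
    P (\bigcap_(i in [set: 'I_n]) (Y i @^-1` B i))) ->
  @measurable_fun _ _ (n.-tuple T') R setT f -> (forall t, 0 <= f t) ->
  (\int[P]_w (f [tuple X i w | i < n])%:E =
   \int[P]_w (f [tuple Y i w | i < n])%:E)%E.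
Proof.
move=> mX mY XY mf f0.
have mtuple (W : 'I_n -> T -> T') : (forall i, measurable_fun setT (W i)) ->
    measurable_fun setT (fun w => [tuple W i w | i < n]).
  move=> mW; apply/measurable_fun_tnthP => i.
  by rewrite (_ : _ \o _ = W i)//; apply/funext => w /=; rewrite tnth_mktuple.
have push (W : 'I_n -> T -> T') : (forall i, measurable_fun setT (W i)) ->
    (\int[P]_w (f [tuple W i w | i < n])%:E =
     \int[pushforward P (fun w => [tuple W i w | i < n])]_t (f t)%:E)%E.
  move=> mW; rewrite ge0_integral_pushforward//; [exact: mtuple| |].
    exact/measurable_EFinP.
  by move=> t _; rewrite lee_fin.
rewrite !push//.
pose mX' := isMeasurableFun.Build _ _ _ _ _ (mtuple _ mX).
pose X' : {mfun T >-> n.-tuple T'} := HB.pack (fun w => [tuple X i w | i < n]) mX'.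
pose mY' := isMeasurableFun.Build _ _ _ _ _ (mtuple _ mY).
pose Y' : {mfun T >-> n.-tuple T'} := HB.pack (fun w => [tuple Y i w | i < n]) mY'.
apply: (@eq_measure_integral _ _ _ setT (pushforward P Y') (pushforward P X')) => A mA _.
apply: (@measure_unique _ _ _ (@tuple_rectangles _ T' n) (fun=> setT) _ _ _ _
  (pushforward P X') (pushforward P Y')) => //.
- exact: measurable_tuple_rectangles.
- move=> _ _ [B mB ->] [C mC ->]; exists (fun i => B i `&` C i).
    by move=> i; apply: measurableI.
  by rewrite -bigcapI.
- by move=> _; exists (fun=> setT) => //; apply/seteqP; split.
- by rewrite bigcup_const.
- move=> _ [B mB ->]; rewrite /pushforward.
  have pre (W : 'I_n -> T -> T') : (fun w => [tuple W i w | i < n]) @^-1`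
      (\bigcap_(i in [set: 'I_n]) [set t | B i (tnth t i)]) =
      \bigcap_(i in [set: 'I_n]) (W i @^-1` B i).
    by apply/seteqP; split=> w h i _; have := h i I; rewrite /= tnth_mktuple.
  by have := XY B mB; rewrite -!pre.
- move=> _; apply: (@le_lt_trans _ _ 1%E); last exact: ltry.
  by apply: probability_le1; rewrite preimage_setT.
Qed.

(* Both copies form a single family indexed by ['I_(n + n)], so that the
   invariance under exchanges is an equality of laws of tuples. *)
Definition swapped_copies (T T' : Type) (n : nat) (Z : 'I_n -> T -> T')
    (e : 'I_n -> bool) (k : 'I_(n + n)) (p : T * T) : T' :=
  match fintype.split k with
  | inl i => Z i (if e i then p.2 else p.1)
  | inr i => Z i (if e i then p.1 else p.2)
  end.

Lemma measurable_swapped_copies (d d' : measure_display) (T : measurableType d)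
    (T' : measurableType d') (n : nat) (Z : 'I_n -> T -> T') (e : 'I_n -> bool) :
  (forall i, measurable_fun setT (Z i)) ->
  forall k, measurable_fun setT (swapped_copies Z e k).
Proof.
move=> mZ k; rewrite /swapped_copies.
by case: fintype.split => i; case: (e i); exact: measurableT_comp.
Qed.

(** The point is that the right side does not depend on [e]: an exchange only permutes the two
    factors attached to each index. *)
Lemma product_swapped_copies (R : realType) (d d' : measure_display)
    (T : measurableType d) (T' : measurableType d') (P : probability T R)
    (n : nat) (Z : 'I_n -> {RV P >-> T'}) (e : 'I_n -> bool)
    (B : 'I_(n + n) -> set T') :
  mutually_independent Z -> (forall k, measurable (B k)) ->
  (P \x P)%E (\bigcap_(k in [set: 'I_(n + n)]) (swapped_copies Z e k @^-1` B k)) =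
  (\prod_(i < n) (P (Z i @^-1` B (lshift n i)) * P (Z i @^-1` B (rshift n i))))%E.
Proof.
move=> Zind mB.
(* [C false] collects the constraints on the first copy and [C true] those on the second, so the
   event is a rectangle in [T * T]. *)
pose C (b : bool) i := if e i (+) b then B (rshift n i) else B (lshift n i).
have mC b i : measurable (C b i) by rewrite /C; case: ifP.
have -> : \bigcap_(k in [set: 'I_(n + n)]) (swapped_copies Z e k @^-1` B k) =
    (\bigcap_(i in [set` [set: 'I_n]%SET]) (Z i @^-1` C false i)) `*`
    (\bigcap_(i in [set` [set: 'I_n]%SET]) (Z i @^-1` C true i)).
  apply/seteqP; split=> [p h|p [h1 h2] k _].
    have hl i := h (lshift n i) I; have hr i := h (rshift n i) I.
    rewrite /swapped_copies/= in hl hr.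
    split=> i _; rewrite /C/=; move: (hl i) (hr i);
      by rewrite -[lshift n i]/(unsplit (inl i)) -[rshift n i]/(unsplit (inr i))
                 !unsplitK; case: (e i).
  rewrite /= /swapped_copies -[k in B k](splitK k).
  case: (fintype.split k) => i /=; have := h1 i; have := h2 i; rewrite /C /= finset.in_setT;
    by case: (e i) => /(_ isT) + /(_ isT).
have mZC b : measurable (\bigcap_(i in [set` [set: 'I_n]%SET]) (Z i @^-1` C b i)).
  by apply: fin_bigcap_measurable => // i _; rewrite -[_ @^-1` _]setTI; exact: measurable_funP.
rewrite (@product_measure1E _ _ _ _ _ P P)//.
rewrite [X in (X * _)%E](Zind _ (C false))// [X in (_ * X)%E](Zind _ (C true))//.
rewrite -big_split/=.
apply: eq_big => [i|i _]; first by rewrite inE.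
by rewrite /C; case: (e i) => //=; rewrite muleC.
Qed.

Lemma integral_swapped_copies (R : realType) (d d' : measure_display)
    (T : measurableType d) (T' : measurableType d') (P : probability T R)
    (n : nat) (Z : 'I_n -> {RV P >-> T'}) (e e' : 'I_n -> bool)
    (f : (n + n).-tuple T' -> R) : mutually_independent Z ->
  @measurable_fun _ _ ((n + n).-tuple T') R setT f -> (forall t, 0 <= f t) ->
  (\int[P \x P]_p (f [tuple swapped_copies Z e k p | k < n + n])%:E =
   \int[P \x P]_p (f [tuple swapped_copies Z e' k p | k < n + n])%:E)%E.
Proof.
move=> Zind mf f0; apply: eq_integral_tuple_law => //.
- by apply: measurable_swapped_copies => i; exact: measurable_funP.
- by apply: measurable_swapped_copies => i; exact: measurable_funP.
- move=> B mB; have h := product_swapped_copies _ Zind mB.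
  exact: etrans (h e) (esym (h e')).
Qed.

(** * Convexity of powers and Jensen's inequality *)

(** This is the tangent inequality of [y]^ m[at]a[, obtained from Young's inequality for]y[and]a
    [^ (m - 1)]. At [m = 1] the conjugate exponent is not finite, hence the separate case. *)
Lemma powR_young (R : realType) (m a y : R) : 1 <= m -> 0 <= a -> 0 <= y ->
  m * a `^ (m - 1) * y <= y `^ m + (m - 1) * a `^ m.
Proof.
move=> m1 a0 y0; have [->|m1'] := eqVneq m 1.
  by rewrite subrr powRr0 powRr1// !mul1r mul0r addr0.
have {}m1' : 0 < m - 1 by rewrite subr_gt0 lt_neqAle eq_sym m1' m1.
have m0 : 0 < m by lra.
have hq : m^-1 + (m / (m - 1))^-1 = 1 by field; rewrite !gt_eqF.
have := @conjugate_powR _ y (a `^ (m - 1)) m (m / (m - 1)) y0 (powR_ge0 _ _) m0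
  (divr_gt0 m0 m1') hq.
rewrite -powRrM (_ : (m - 1) * _ = m); last by field; rewrite gt_eqF.
rewrite -(ler_pM2l m0) => /le_trans h; rewrite -mulrA [_ `^ _ * y]mulrC; apply: h.
by rewrite le_eqVlt; apply/orP; left; apply/eqP; field; rewrite !gt_eqF.
Qed.

(** Triangle inequality, then convexity of the power at the midpoint of [|x|] and [|y|]. *)
Lemma powR_normB_le (R : realType) (m x y : R) : 1 <= m ->
  `|x - y| `^ m <= 2 `^ m / 2 * (`|x| `^ m + `|y| `^ m).
Proof.
move=> m1; have m0 : 0 <= m by lra.
apply: (@le_trans _ _ ((`|x| + `|y|) `^ m)).
  by rewrite ge0_ler_powR ?nnegrE ?addr_ge0 ?ler_normB//.
have h2 : 0 <= (2^-1 : R) <= 1 by lra.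
have := @convex_powR R m m1 (Itv01 (andP h2).1 (andP h2).2) `|x| `|y|.
rewrite !inE/= !in_itv/= !andbT !normr_ge0 => /(_ isT isT).
rewrite convRE [X in X `^ _ <= _ -> _]convRE/= /unstable.onem.
have -> : 1 - 2^-1 = 2^-1 :> R by lra.
rewrite -!mulrDr powRM ?invr_ge0 ?addr_ge0//.
have -> : 2^-1 `^ m = (2 `^ m)^-1 :> R by rewrite -powR_inv1// -powRrM mulN1r powRN.
by rewrite ler_pdivrMl ?powR_gt0 ?mulrA.
Qed.

Lemma EFin_bigmax_le (R : realType) (I : finType) (F : I -> R) (x : \bar R) :
  (0 <= x)%E -> (forall i, ((F i)%:E <= x)%E) ->
  ((\big[Num.max/0]_i F i)%:E <= x)%E.
Proof.
move=> x0 Fx; elim/big_ind: _ => // a b; rewrite EFin_max.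
by rewrite ge_max => -> ->.
Qed.

Lemma measurable_bigmax (R : realType) (d : measure_display)
    (T : measurableType d) (I : finType) (F : I -> T -> R) :
  (forall i, measurable_fun setT (F i)) ->
  measurable_fun setT (fun w => \big[Num.max/0]_i F i w).
Proof.
move=> mF; elim: (index_enum I) => [|i s ih].
  by under eq_fun do rewrite big_nil; exact: measurable_cst.
by under eq_fun do rewrite big_cons; exact: measurable_maxr.
Qed.

Lemma powR_integral_le (R : realType) (d : measure_display)
    (T : measurableType d) (P : probability T R) (m : R) (Y : T -> R) :
  1 <= m -> P.-integrable setT (EFin \o Y) ->
  ((`|fine (\int[P]_w (Y w)%:E)| `^ m)%:E <= \int[P]_w (`|Y w| `^ m)%:E)%E.
Proof.
move=> m1 iY.
have mY : measurable_fun setT Y by apply/measurable_EFinP; exact: measurable_int iY.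
have mnY : measurable_fun setT (fun w => `|Y w|) by exact: measurableT_comp.
have mpY : measurable_fun setT (fun w => `|Y w| `^ m).
  by apply: (measurableT_comp (measurable_powR m)).
have iaY := integrable_abse iY.
have faY : (\int[P]_w `|Y w|%:E)%E \is a fin_num by exact: integrable_fin_num iaY.
have faE : (\int[P]_w (Y w)%:E)%E \is a fin_num by exact: integrable_fin_num iY.
pose a := fine (\int[P]_w `|Y w|%:E)%E.
have aE : a%:E = (\int[P]_w `|Y w|%:E)%E by rewrite fineK.
have a0 : 0 <= a by apply: fine_ge0; apply: integral_ge0 => *; rewrite lee_fin.
apply: (@le_trans _ _ (a `^ m)%:E).
  rewrite lee_fin ge0_ler_powR ?nnegrE//; first lra.
  rewrite -lee_fin aE -fine_abse// fineK ?abse_fin_num//.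
  by apply: le_abse_integral => //; exact/measurable_EFinP.
(* Jensen's inequality comes from integrating the tangent inequality at the mean [a] of [|Y|]: the
   left side becomes [m * a]^ m[, and](m - 1) * a [^ m] cancels. *)
have : (\int[P]_w ((m * a `^ (m - 1)) * `|Y w|)%:E <=
        \int[P]_w ((`|Y w| `^ m)%:E + ((m - 1) * a `^ m)%:E))%E.
  apply: ge0_le_integral => //.
  - by move=> w _; rewrite lee_fin !mulr_ge0 ?powR_ge0//; lra.
  - by apply/measurable_EFinP; apply: measurable_funM.
  - by apply: emeasurable_funD => //; exact/measurable_EFinP.
  - by move=> w _; rewrite -EFinD lee_fin powR_young.
have m10 : 0 <= (m - 1) * a `^ m by rewrite mulr_ge0 ?powR_ge0//; lra.
rewrite ge0_integralD//; last exact/measurable_EFinP.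
under [X in (X <= _)%E -> _]eq_integral do rewrite EFinM.
rewrite ge0_integralZl_EFin//; last 2 first.
- exact/measurable_EFinP.
- by rewrite mulr_ge0 ?powR_ge0//; lra.
rewrite -aE integral_cst//= probability_setT mule1.
rewrite -EFinM -mulrA [_ `^ _ * a]mulrC mulr_powRB1//; last lra.
have : (0 <= \int[P]_w (`|Y w| `^ m)%:E)%E.
  by apply: integral_ge0 => w _; rewrite lee_fin powR_ge0.
(* The moment on the right may be infinite, and then the bound is trivial. *)
case: (integral _ _ _) => [r _|_ _|//]; last by rewrite leey.
by rewrite -EFinD !lee_fin; lra.
Qed.

(** * Symmetrization *)

(** For [m >= 1] this is the [m]-th power of the sup norm of the vector sum. *)
Definition max_powR_sum (R : realType) (n M : nat) (m : R)
    (a : 'I_n -> 'I_M -> R) : R :=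
  \big[Num.max/0]_(j < M) (`|\sum_i a i j| `^ m).

Lemma max_powR_sum_ge0 (R : realType) (n M : nat) (m : R)
  (a : 'I_n -> 'I_M -> R) : 0 <= max_powR_sum m a.
Proof. exact: bigmax_ge_id. Qed.

Lemma measurable_max_powR_sum (R : realType) (d : measure_display)
    (T : measurableType d) (n M : nat) (m : R) (a : T -> 'I_n -> 'I_M -> R) :
  (forall i j, measurable_fun setT (fun w => a w i j)) ->
  measurable_fun setT (fun w => max_powR_sum m (a w)).
Proof.
move=> ma; apply: measurable_bigmax => j.
apply: (measurableT_comp (measurable_powR m)); apply: measurableT_comp => //.
exact: measurable_sum.
Qed.

Lemma max_powR_sumB_le (R : realType) (n M : nat) (m : R)
    (a b : 'I_n -> 'I_M -> R) : 1 <= m ->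
  max_powR_sum m (fun i j => a i j - b i j) <=
  2 `^ m / 2 * (max_powR_sum m a + max_powR_sum m b).
Proof.
move=> m1; have c0 : 0 <= 2 `^ m / 2 :> R by rewrite divr_ge0 ?powR_ge0.
apply: bigmax_le => [|j _].
  by rewrite mulr_ge0 ?addr_ge0 ?max_powR_sum_ge0.
rewrite sumrB; apply: le_trans (powR_normB_le _ _ m1) _.
by rewrite ler_wpM2l// lerD//; exact: (le_bigmax _ (fun j => `|\sum_i _ i j| `^ m)).
Qed.

(** Jensen's inequality is applied to each coordinate sum separately, and the maximum is then taken
    inside the integral. *)
Lemma max_powR_sum_centered_le (R : realType) (d : measure_display)
    (T : measurableType d) (P : probability T R) (n M : nat) (m : R)
    (X : T -> 'I_n -> 'I_M -> R) (z : 'I_n -> 'I_M -> R) : 1 <= m ->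
  (forall i j, P.-integrable setT (fun w => (X w i j)%:E)) ->
  ((max_powR_sum m (fun i j => z i j - fine (\int[P]_w (X w i j)%:E)))%:E <=
   \int[P]_w (max_powR_sum m (fun i j => z i j - X w i j))%:E)%E.
Proof.
move=> m1 iX.
have mX i j : measurable_fun setT (fun w => X w i j).
  by apply/measurable_EFinP; exact: measurable_int (iX i j).
have mN : measurable_fun setT
    (fun w => max_powR_sum m (fun i j => z i j - X w i j)).
  apply: measurable_max_powR_sum => i j.
  by apply: measurable_funB => //; exact: measurable_cst.
apply: EFin_bigmax_le => [|j].
  by apply: integral_ge0 => w _; rewrite lee_fin max_powR_sum_ge0.
pose Y w := \sum_i (z i j - X w i j).
have icst i : P.-integrable setT (fun=> (z i j)%:E).
  exact: finite_measure_integrable_cst.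
have iD i : P.-integrable setT (fun w => (z i j - X w i j)%:E).
  by have := integrableB measurableT (icst i) (iX i j).
have iY : P.-integrable setT (EFin \o Y).
  have := @integrable_sum _ _ _ P setT measurableT _ (index_enum 'I_n) xpredT
    (fun i w => (z i j - X w i j)%:E) (fun i _ => iD i).
  by congr (integrable _ _ _); apply/funext => w; rewrite /Y /= sumEFin.
have EY : (\int[P]_w (Y w)%:E)%E =
    (\sum_i (z i j - fine (\int[P]_w (X w i j)%:E)))%:E.
  under eq_integral do rewrite -sumEFin.
  rewrite integral_sum//.
  rewrite -sumEFin; apply: eq_bigr => i _.
  rewrite (integralB_EFin (f1 := fun=> z i j))//; [|exact: icst|exact: iX].
  rewrite integral_cst//= probability_setT mule1 EFinB fineK//.
  exact: integrable_fin_num (iX i j).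
have := powR_integral_le m1 iY; rewrite EY/= => h; apply: (le_trans h).
apply: ge0_le_integral => //.
- apply/measurable_EFinP; apply: (measurableT_comp (measurable_powR m)).
  apply: measurableT_comp => //; apply: measurable_sum => i.
  by apply: measurable_funB => //; exact: measurable_cst.
- exact/measurable_EFinP.
- move=> w _; rewrite lee_fin.
  exact: (le_bigmax _ (fun j => `|\sum_i (z i j - X w i j)| `^ m)).
Qed.

Lemma symmetrization (R : realType) (d : measure_display) (T : measurableType d)
    (P : probability T R) (n M : nat) (m : R)
    (Z : 'I_n -> {RV P >-> (M.-tuple R)%type}) (e : 'I_n -> bool) :
  1 <= m -> mutually_independent Z ->
  (forall i j, P.-integrable setT (EFin \o component (Z i) j)) ->
  (\int[P]_w (max_powR_sum m (fun i j =>
      component (Z i) j w - fine (\int[P]_w (component (Z i) j w)%:E)))%:E <=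
   (2 `^ m)%:E *
   \int[P]_w (max_powR_sum m (fun i j => (-1) ^+ e i * component (Z i) j w))%:E)%E.
Proof.
move=> m1 Zind Zint.
have mZ i j : measurable_fun setT (component (Z i) j).
  by apply/measurable_EFinP; exact: measurable_int (Zint i j).
pose N (a : 'I_n -> 'I_M -> R) := max_powR_sum m a.
have N0 a : 0 <= N a by exact: max_powR_sum_ge0.
pose D p i j := component (Z i) j p.1 - component (Z i) j p.2.
pose S w i j := (-1) ^+ e i * component (Z i) j w.
have mD i j : measurable_fun setT (fun p => D p i j).
  by apply: measurable_funB; exact: measurableT_comp.
have mS i j : measurable_fun setT (fun w => S w i j).
  by apply: measurable_funM => //; exact: measurable_cst.
have mND : measurable_fun setT (fun p => N (D p)) by exact: measurable_max_powR_sum.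
have mNS : measurable_fun setT (fun p => N (S p)) by exact: measurable_max_powR_sum.
apply: (@le_trans _ _ (\int[P \x P]_p (N (D p))%:E)%E).
  rewrite fubini_tonelli1//; last 2 first.
  - exact/measurable_EFinP.
  - by move=> p; rewrite lee_fin.
  apply: ge0_le_integral => //.
  - by move=> w _; rewrite lee_fin.
  - apply/measurable_EFinP; apply: measurable_max_powR_sum => i j.
    by apply: measurable_funB => //; exact: measurable_cst.
  - apply: measurable_fun_fubini_tonelli_F; first exact/measurable_EFinP.
    by move=> p; rewrite lee_fin.
  - by move=> w _; exact: max_powR_sum_centered_le.
(* As a function of the joined family, [f] sees the difference of its two halves; exchanging the
   copies at index [i] flips the sign of [D p i]. *)
pose f (t : (n + n).-tuple (M.-tuple R)) := N (fun i j =>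
  tnth (tnth t (lshift n i)) j - tnth (tnth t (rshift n i)) j).
have mf : @measurable_fun _ _ ((n + n).-tuple (M.-tuple R)) R setT f.
  apply: measurable_max_powR_sum => i j.
  apply: measurable_funB;
    exact: (measurableT_comp (measurable_tnth j) (measurable_tnth _)).
have fE (e' : 'I_n -> bool) p :
    f [tuple swapped_copies Z e' k p | k < n + n] =
    N (fun i j => (-1) ^+ e' i * D p i j).
  congr N; apply/funext => i; apply/funext => j; rewrite !tnth_mktuple.
  rewrite /swapped_copies -[lshift n i]/(unsplit (inl i)).
  rewrite -[rshift n i]/(unsplit (inr i)) !unsplitK /D /component.
  by case: (e' i); rewrite ?expr1 ?expr0 ?mul1r ?mulN1r ?opprB.
have -> : (\int[P \x P]_p (N (D p))%:E =
    \int[P \x P]_p (N (fun i j => (-1) ^+ e i * D p i j)%R)%:E)%E.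
  have := integral_swapped_copies (fun=> false) e Zind mf (fun t => N0 _).
  under eq_integral do rewrite fE.
  under [X in _ = X -> _]eq_integral do rewrite fE.
  move=> <-; apply: eq_integral => p _; congr (N _)%:E.
  by apply/funext => i; apply/funext => j; rewrite expr0 mul1r.
have int1 : (\int[P \x P]_p (N (S p.1))%:E = \int[P]_w (N (S w))%:E)%E.
  rewrite fubini_tonelli1//; last 2 first.
  - by apply/measurable_EFinP; exact: (measurableT_comp mNS).
  - by move=> p; rewrite lee_fin.
  apply: eq_integral => w _.
  by rewrite /fubini_F/= integral_cst//= probability_setT mule1.
have int2 : (\int[P \x P]_p (N (S p.2))%:E = \int[P]_w (N (S w))%:E)%E.
  rewrite fubini_tonelli2//; last 2 first.
  - by apply/measurable_EFinP; exact: (measurableT_comp mNS).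
  - by move=> p; rewrite lee_fin.
  apply: eq_integral => w _.
  by rewrite /fubini_G/= integral_cst//= probability_setT mule1.
have c0 : 0 <= 2 `^ m / 2 :> R by rewrite divr_ge0 ?powR_ge0.
have mN1 : measurable_fun setT (fun p : T * T => (N (S p.1))%:E).
  by apply/measurable_EFinP; exact: (measurableT_comp mNS).
have mN2 : measurable_fun setT (fun p : T * T => (N (S p.2))%:E).
  by apply/measurable_EFinP; exact: (measurableT_comp mNS).
apply: (@le_trans _ _ (\int[P \x P]_p
    ((2 `^ m / 2)%:E * ((N (S p.1))%:E + (N (S p.2))%:E)))%E).
  apply: ge0_le_integral => //.
  - by move=> p _; rewrite lee_fin.
  - apply/measurable_EFinP; apply: measurable_max_powR_sum => i j.
    by apply: measurable_funM => //; exact: measurable_cst.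
  - by apply: emeasurable_funM => //; exact: emeasurable_funD.
  - move=> p _; rewrite -EFinD -EFinM lee_fin.
    apply: le_trans (max_powR_sumB_le _ _ m1).
    rewrite le_eqVlt; apply/orP; left; apply/eqP; congr N.
    by apply/funext => i; apply/funext => j; rewrite /S -mulrBr.
rewrite ge0_integralZl_EFin//; last 2 first.
- by move=> p _; rewrite adde_ge0 ?lee_fin.
- exact: emeasurable_funD.
rewrite ge0_integralD//; try by move=> p _; rewrite lee_fin.
rewrite [X in (_ * (X + _))%E]int1 [X in (_ * (_ + X))%E]int2.
have I0 : (0 <= \int[P]_w (N (S w))%:E)%E.
  by apply: integral_ge0 => w _; rewrite lee_fin.
by rewrite ge0_muleDr// -ge0_muleDl ?lee_fin// -EFinD -splitr.
Qed.

(** * The constant [c_min] and the final bound *)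

(** Division by [M] shows a closed half-line, so the infimum is attained and explicit. *)
Lemma c_admissibleE (R : realType) (M : nat) (m : R) : (1 <= M)%N -> 1 <= m ->
  c_admissible M m = [set c | 2 + (expR (m - 1) - 1) / M%:R <= c].
Proof.
move=> M1 m1; have M0 : 0 < M%:R :> R by rewrite ltr0n.
have em : 1 <= expR (m - 1) by have := expR_ge1Dx (m - 1); lra.
have q0 : 0 <= (expR (m - 1) - 1) / M%:R by rewrite divr_ge0 ?(ltW M0)//; lra.
rewrite /c_admissible; apply/seteqP; split=> c /=; rewrite -ler_pdivrMr//; first by case; lra.
by move=> hc; split; lra.
Qed.

Lemma c_minE (R : realType) (M : nat) (m : R) : (1 <= M)%N -> 1 <= m ->
  c_min M m = 2 + (expR (m - 1) - 1) / M%:R.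
Proof.
move=> M1 m1; rewrite /c_min c_admissibleE//.
apply/eqP; rewrite eq_le; apply/andP; split.
  by apply: ge_inf => /=; [exists (2 + (expR (m - 1) - 1) / M%:R)|].
by apply: lb_le_inf => //=; exists (2 + (expR (m - 1) - 1) / M%:R) => /=.
Qed.
Unset Implicit Arguments.
Set Strict Implicit.

(* Each maximum below is over nonnegative values and a nonempty index set, so
   starting the iterated Num.max at 0 does not change it. *)
Theorem lemma9p1 (R : realType) (d : measure_display) (T : measurableType d)
    (P : probability T R) (n M : nat) (m : R)
    (Z : 'I_n -> {RV P >-> (M.-tuple R)%type})
    (HM : (1 <= M)%N) (Hm : 1 <= m)
    (Zind : mutually_independent Z)
    (Zint : forall (i : 'I_n) (j : 'I_M),
        P.-integrable setT (EFin \o component (Z i) j)) :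
  [/\ (c_admissible M m (c_min M m) /\
        (forall c : R, c_admissible M m c -> c_min M m <= c)),
      ('E_P[fun w => (\big[Num.max/0]_(j < M)
              (`| \sum_(i < n) (component (Z i) j w
                                - fine 'E_P[component (Z i) j]%E) | `^ m))%R]
       <= ((8 * ln (c_min M m * M%:R)) `^ (m / 2))%R%:E *
          'E_P[fun w => ((\big[Num.max/0]_(j < M)
                            \sum_(i < n) component (Z i) j w ^+ 2)
                         `^ (m / 2))%R])%E
    & 2 <= c_min M m <= expR (m - 1) + 1].
Proof.
have M0 : 0 < M%:R :> R by rewrite ltr0n.
have em : 1 <= expR (m - 1) by have := expR_ge1Dx (m - 1); lra.
have cE := c_minE HM Hm; have cadm : c_admissible M m (c_min M m).
  by rewrite c_admissibleE//= cE.
split; first by split=> // c; rewrite c_admissibleE//= cE.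
- have mZ i j : measurable_fun setT (component (Z i) j).
    by apply/measurable_EFinP; exact: measurable_int (Zint i j).
  set c := c_min M m in cadm *.
  have c2 : 2 <= c by rewrite /c cE lerDl divr_ge0 ?(ltW M0)//; lra.
  have L0 : 0 <= ln (c * M%:R).
    apply: ln_ge0; apply: (@le_trans _ _ (2 * 1)); first lra.
    by rewrite ler_pM// ler1n.
  (* The [8] is [4 * 2]: [4]^ (m / 2) = 2 [^ m] is the cost of symmetrization, and [2] comes from
     the sign average. *)
  have -> : (8 * ln (c * M%:R)) `^ (m / 2) =
      2 `^ m * (2 * ln (c * M%:R)) `^ (m / 2).
    rewrite (_ : 8 * _ = 4 * (2 * ln (c * M%:R))); last by ring.
    rewrite powRM ?mulr_ge0//; congr (_ * _).
    by rewrite mulrC powRrM powR12_sqrt// (_ : 4 = 2 ^+ 2) ?sqrtr_sqr ?ger0_norm//; ring.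
  rewrite expectation.unlock.
  set I := (X in (X <= _)%E); set V := (X in (_ * X)%E).
  pose v w : R := \big[Num.max/0]_(j < M) \sum_(i < n) component (Z i) j w ^+ 2.
  pose S (e : {ffun 'I_n -> bool}) w : R :=
    max_powR_sum m (fun i j => (-1) ^+ e i * component (Z i) j w).
  have mS e : measurable_fun setT (S e).
    apply: measurable_max_powR_sum => i j.
    by apply: measurable_funM => //; exact: measurable_cst.
  have mv : measurable_fun setT (fun w => v w `^ (m / 2)).
    apply: (measurableT_comp (measurable_powR (m / 2))).
    apply: measurable_bigmax => j; apply: measurable_sum => i.
    exact: measurable_funX.
  have S0 e w : 0 <= S e w by exact: max_powR_sum_ge0.
  have IS e : (I <= (2 `^ m)%:E * \int[P]_w (S e w)%:E)%E.
    exact: (symmetrization e Hm Zind Zint).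
  have sumS : (\sum_(e : {ffun 'I_n -> bool}) \int[P]_w (S e w)%:E <=
      (2 ^+ n * (2 * ln (c * M%:R)) `^ (m / 2))%:E * V)%E.
    rewrite -ge0_integral_sum//; last 2 first.
    - by move=> e; exact/measurable_EFinP.
    - by move=> e w _; rewrite lee_fin.
    rewrite -ge0_integralZl_EFin//; last 3 first.
    - by move=> w _; rewrite lee_fin powR_ge0.
    - exact/measurable_EFinP.
    - by rewrite mulr_ge0 ?exprn_ge0 ?powR_ge0.
    apply: ge0_le_integral => //.
    - by move=> w _; apply: sume_ge0 => e _; rewrite lee_fin.
    - by apply: emeasurable_sum => e; exact/measurable_EFinP.
    - by apply: emeasurable_funM => //; exact/measurable_EFinP.
    - move=> w _; rewrite sumEFin -EFinM lee_fin -mulrA.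
      exact: (sum_sign_bigmax_powR_le _ HM Hm cadm.2).
  have sumI : ((2 ^+ n)%:E * I <=
      (2 `^ m)%:E * \sum_(e : {ffun 'I_n -> bool}) \int[P]_w (S e w)%:E)%E.
    rewrite ge0_sume_distrr; last first.
      by move=> e _; apply: integral_ge0 => w _; rewrite lee_fin.
    rewrite (_ : (2 ^+ n)%:E = (\sum_(e : {ffun 'I_n -> bool}) 1%:E)%E); last first.
      by rewrite sumEFin sumr_const card_ffun card_bool card_ord natrX.
    rewrite ge0_sume_distrl//.
    by apply: lee_sum => e _; rewrite mul1e.
  (* The mean over signs appears as a sum over all [2 ^+ n] sign vectors on both sides; this
     positive finite factor cancels even if the moments are infinite. *)
  rewrite -(@lee_pmul2l _ (2 ^+ n)%:E) ?lte_fin ?exprn_gt0//.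
  apply: (le_trans sumI); rewrite [leRHS]muleA -EFinM mulrCA EFinM -muleA.
  by rewrite lee_wpmul2l// lee_fin powR_ge0.
- rewrite cE lerDl divr_ge0 ?(ltW M0)//=; last lra.
  have : (expR (m - 1) - 1) / M%:R <= expR (m - 1) - 1.
    by rewrite ler_pdivrMr// ler_peMr ?ler1n//; lra.
  lra.
Qed.
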